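(* (i) Any finitely complete category $\mathbb{E}$ in which any $\mathbb P_{\mathbb E}$-invertible monomorphism of $\mathrm{Pt}\,\mathbb E$ is a $\mathbb P_{\mathbb E}$-outsider is necessarily a Mal'tsev category. (ii) If $\mathbb{E}$ is a finitely complete protomodular category, then any $\mathbb P_{\mathbb E}$-invertible monomorphism of $\mathrm{Pt}\,\mathbb E$ is a $\mathbb P_{\mathbb E}$-outsider. Moreover, any monomorphic decomposition in $\mathrm{Pt}\,\mathbb E$ of the form $$(f',s')\xrightarrow{(y,x)}(\bar f,\bar s)\xrightarrow{(1_Y,\bar x)}(f,s),$$ where $(f',s'):X'\rightleftarrows Y'$, $(\bar f,\bar s):\bar X\rightleftarrows Y$ and $(f,s):X\rightleftarrows Y$ are split epimorphisms, $(y,x)$ is a $\mathbb P_{\mathbb E}$-cartesian monomorphism (i.e. the square $\bar f.x=y.f'$ is a pullback) and $(1_Y,\bar x)$ is a $\mathbb P_{\mathbb E}$-invertible monomorphism, is a $\mathbb P_{\mathbb E}$-extremal decomposition of the composite $(y,\bar x.x)$.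
   Context: $\mathrm{Pt}\,\mathbb{E}$ is the category whose objects are the split epimorphisms $(f,s):X\rightleftarrows Y$, $f.s=1_Y$, with chosen splitting, and whose maps $(y,x):(f',s')\to(f,s)$ are pairs with $f.x=y.f'$ and $x.s'=s.y$. $\mathbb P_{\mathbb E}:\mathrm{Pt}\,\mathbb E\to\mathbb E$ sends $(f,s)$ to the codomain $Y$ of $f$; its fibre over $Y$ is $\mathrm{Pt}_Y\mathbb E$. A map $(y,x)$ is $\mathbb P_{\mathbb E}$-cartesian iff $f.x=y.f'$ is a pullback square, and $\mathbb P_{\mathbb E}$-invertible iff $y$ is an isomorphism. A decomposition $v=w.u$ of a monomorphism $v:U\rightarrowtail T$ of $\mathrm{Pt}\,\mathbb E$, with $u:U\to X$ $\mathbb P_{\mathbb E}$-cartesian, is $\mathbb P_{\mathbb E}$-extremal when for any other decomposition $v=w'.u'$ with $u':U\to X'$ $\mathbb P_{\mathbb E}$-cartesian there is a unique $t:X'\to X$ with $w.t=w'$ and $t.u'=u$. The monomorphism $v$ is a $\mathbb P_{\mathbb E}$-outsider when $v=v.1_U$ is a $\mathbb P_{\mathbb E}$-extremal decomposition. A Mal'tsev category is a (finitely complete) category in which any reflexive relation is an equivalence relation. $\mathbb{E}$ is protomodular when every base-change functor $y^*:\mathrm{Pt}_Y\mathbb E\to \mathrm{Pt}_{Y'}\mathbb E$ (pulling back along $y:Y'\to Y$) is conservative. *)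

(* Defs.v *)
From Stdlib Require Import FinFun ProofIrrelevance.

(** * Categories and functors *)

Record Category : Type := {
  Ob :> Type;
  Hom : Ob -> Ob -> Type;
  id : forall A, Hom A A;
  comp : forall {A B C}, Hom B C -> Hom A B -> Hom A C;
  comp_id_l : forall A B (f : Hom A B), comp (id B) f = f;
  comp_id_r : forall A B (f : Hom A B), comp f (id A) = f;
  comp_assoc : forall A B C D (h : Hom C D) (g : Hom B C) (f : Hom A B),
    comp h (comp g f) = comp (comp h g) f
}.

Arguments Hom {c} _ _.
Arguments id {c} _.
Arguments comp {c} {A B C} _ _.
Arguments comp_id_l {c A B} f.
Arguments comp_id_r {c A B} f.
Arguments comp_assoc {c A B C D} h g f.

Infix "∘" := comp (at level 40, left associativity).

Record Functor (C D : Category) : Type := {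
  fob :> C -> D;
  fmap : forall {A B : C}, Hom A B -> Hom (fob A) (fob B);
  fmap_id : forall A : C, fmap (id A) = id (fob A);
  fmap_comp : forall (A B X : C) (g : Hom B X) (f : Hom A B),
    fmap (g ∘ f) = fmap g ∘ fmap f
}.

Arguments fob {C D} _ _.
Arguments fmap {C D} _ {A B} _.
Arguments fmap_id {C D} _ A.
Arguments fmap_comp {C D} _ {A B X} g f.

Definition is_iso {C : Category} {A B : C} (f : Hom A B) : Prop :=
  exists g : Hom B A, g ∘ f = id A /\ f ∘ g = id B.

Definition is_mono {C : Category} {A B : C} (f : Hom A B) : Prop :=
  forall (T : C) (a b : Hom T A), f ∘ a = f ∘ b -> a = b.

Definition conservative {C D : Category} (F : Functor C D) : Prop :=
  forall (A B : C) (f : Hom A B), is_iso (fmap F f) -> is_iso f.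

(** The commutative square [f ∘ p = g ∘ q] is a pullback. *)
Definition is_pullback {C : Category} {P A B X : C}
    (p : Hom P A) (q : Hom P B) (f : Hom A X) (g : Hom B X) : Prop :=
  f ∘ p = g ∘ q /\
  forall (T : C) (a : Hom T A) (b : Hom T B), f ∘ a = g ∘ b ->
    exists! m : Hom T P, p ∘ m = a /\ q ∘ m = b.

(** * Finite limits *)

Record Cone {J C : Category} (D : Functor J C) : Type := {
  apex : C;
  leg : forall j : J, Hom apex (D j);
  leg_natural : forall (i j : J) (u : Hom i j), fmap D u ∘ leg i = leg j
}.

Arguments apex {J C D} _.
Arguments leg {J C D} _ _.
Arguments leg_natural {J C D} _ {i j} u.

Record Limit {J C : Category} (D : Functor J C) : Type := {
  lim :> Cone D;
  lim_lift : forall c : Cone D, Hom (apex c) (apex lim);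
  lim_lift_leg : forall (c : Cone D) (j : J),
    leg lim j ∘ lim_lift c = leg c j;
  lim_lift_unique : forall (c : Cone D) (m : Hom (apex c) (apex lim)),
    (forall j : J, leg lim j ∘ m = leg c j) -> m = lim_lift c
}.

Arguments lim {J C D} _.
Arguments lim_lift {J C D} _ c.
Arguments lim_lift_leg {J C D} _ c j.
Arguments lim_lift_unique {J C D} _ c m _.

Definition finite_category (J : Category) : Prop :=
  Finite J /\ forall i j : J, Finite (Hom i j).

(** Limits are chosen, so that base-change is a functor without appeal to the
    axiom of choice. *)
Definition FinitelyComplete (C : Category) : Type :=
  forall J : Category, finite_category J -> forall D : Functor J C, Limit D.

(** ** Chosen pullbacks, as limits of shape [left -> corner <- right] *)

Inductive cospan_ob : Set := c_left | c_right | c_corner.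

Definition cospan_hom (i j : cospan_ob) : Set :=
  match i, j with
  | c_left, c_right | c_right, c_left
  | c_corner, c_left | c_corner, c_right => Empty_set
  | _, _ => unit
  end.

Definition cospan : Category.
Proof.
  refine {| Ob := cospan_ob; Hom := cospan_hom |}.
  Unshelve.
  4: intros []; exact tt.
  4: intros [] [] []; simpl; tauto.
  - intros [] [] []; reflexivity.
  - intros [] [] []; reflexivity.
  - intros [] [] [] [] [] [] []; reflexivity.
Defined.

Lemma cospan_finite : finite_category cospan.
Proof.
  split.
  - exists (c_left :: c_right :: c_corner :: nil)%list; intros []; simpl; tauto.
  - intros [] []; solve [ exists (tt :: nil)%list; intros []; simpl; tauto
                        | exists nil; intros [] ].
Qed.

Definition cospan_diagram {C : Category} {A B X : C}
    (f : Hom A X) (g : Hom B X) : Functor cospan C.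
Proof.
  refine {|
    fob := fun i : cospan =>
      match i with c_left => A | c_right => B | c_corner => X end;
    fmap := fun i j : cospan =>
      match i, j with
      | c_left, c_left => fun _ => id A
      | c_right, c_right => fun _ => id B
      | c_corner, c_corner => fun _ => id X
      | c_left, c_corner => fun _ => f
      | c_right, c_corner => fun _ => g
      | _, _ => fun e => match e with end
      end |}.
  - intros []; reflexivity.
  - intros [] [] [] [] []; simpl;
      rewrite ?comp_id_l, ?comp_id_r; reflexivity.
Defined.

Definition cospan_cone {C : Category} {A B X T : C}
    {f : Hom A X} {g : Hom B X} (a : Hom T A) (b : Hom T B)
    (H : f ∘ a = g ∘ b) : Cone (cospan_diagram f g).
Proof.
  refine {|
    apex := T;
    leg := fun j : cospan =>
      match j return Hom T (cospan_diagram f g j) with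
      | c_left => a | c_right => b | c_corner => f ∘ a
      end |}.
  intros [] [] []; simpl; rewrite ?comp_id_l; auto.
Defined.

Section ChosenPullback.
Context {C : Category} (L : FinitelyComplete C)
        {A B X : C} (f : Hom A X) (g : Hom B X).

Definition pb_limit : Limit (cospan_diagram f g) := L cospan cospan_finite _.

Definition pb : C := apex pb_limit.
Definition pb1 : Hom pb A := leg pb_limit c_left.
Definition pb2 : Hom pb B := leg pb_limit c_right.

Lemma pb_comm : f ∘ pb1 = g ∘ pb2.
Proof.
  exact (eq_trans
    (leg_natural pb_limit (tt : @Hom cospan c_left c_corner))
    (eq_sym (leg_natural pb_limit (tt : @Hom cospan c_right c_corner)))).
Qed.

Definition pb_pair {T : C} (a : Hom T A) (b : Hom T B) (H : f ∘ a = g ∘ b) :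
  Hom T pb := lim_lift pb_limit (cospan_cone a b H).

Lemma pb1_pair {T : C} (a : Hom T A) (b : Hom T B) (H : f ∘ a = g ∘ b) :
  pb1 ∘ pb_pair a b H = a.
Proof. exact (lim_lift_leg pb_limit (cospan_cone a b H) c_left). Qed.

Lemma pb2_pair {T : C} (a : Hom T A) (b : Hom T B) (H : f ∘ a = g ∘ b) :
  pb2 ∘ pb_pair a b H = b.
Proof. exact (lim_lift_leg pb_limit (cospan_cone a b H) c_right). Qed.

Lemma pb_ext {T : C} (m n : Hom T pb) :
  pb1 ∘ m = pb1 ∘ n -> pb2 ∘ m = pb2 ∘ n -> m = n.
Proof.
  intros H1 H2.
  assert (H : f ∘ (pb1 ∘ n) = g ∘ (pb2 ∘ n))
    by (rewrite !comp_assoc, pb_comm; reflexivity).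
  assert (K : forall k : Hom T pb, pb1 ∘ k = pb1 ∘ n -> pb2 ∘ k = pb2 ∘ n ->
              k = pb_pair _ _ H).
  { intros k K1 K2. apply (lim_lift_unique pb_limit (cospan_cone _ _ H)).
    intros []; simpl; try assumption.
    rewrite <- (leg_natural pb_limit (tt : @Hom cospan c_left c_corner)).
    rewrite <- comp_assoc. simpl. f_equal. exact K1. }
  rewrite (K m H1 H2). symmetry. apply K; reflexivity.
Qed.

Lemma pb_is_pullback : is_pullback pb1 pb2 f g.
Proof.
  split; [exact pb_comm|]. intros T a b H. exists (pb_pair a b H). split.
  - split; [apply pb1_pair | apply pb2_pair].
  - intros m [<- <-]. apply pb_ext; [apply pb1_pair | apply pb2_pair].
Qed.

End ChosenPullback.

(** * Cartesian and invertible maps, extremal decompositions and outsiders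
    with respect to a functor *)

Definition cartesian {C D : Category} (U : Functor C D) {A B : C}
    (f : Hom A B) : Prop :=
  forall (Z : C) (g : Hom Z B) (h : Hom (U Z) (U A)),
    fmap U f ∘ h = fmap U g ->
    exists! k : Hom Z A, fmap U k = h /\ f ∘ k = g.

Definition invertible {C D : Category} (U : Functor C D) {A B : C}
    (f : Hom A B) : Prop := is_iso (fmap U f).

(** [v = w ∘ u] is an extremal decomposition of the monomorphism [v];
    neither [w] nor the competing [w'] is required to be a monomorphism. *)
Definition extremal_decomposition {C D : Category} (P : Functor C D)
    {U X T : C} (v : Hom U T) (u : Hom U X) (w : Hom X T) : Prop :=
  is_mono v /\ v = w ∘ u /\ cartesian P u /\
  forall (X' : C) (u' : Hom U X') (w' : Hom X' T),
    cartesian P u' -> v = w' ∘ u' ->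
    exists! t : Hom X' X, w ∘ t = w' /\ t ∘ u' = u.

Definition outsider {C D : Category} (P : Functor C D) {U T : C}
    (v : Hom U T) : Prop :=
  extremal_decomposition P v (id U) v.

(** * Split epimorphisms and the category [Pt E] *)

Record SplitEpi {E : Category} (X Y : E) : Type := {
  sp_f : Hom X Y;
  sp_s : Hom Y X;
  sp_eq : sp_f ∘ sp_s = id Y
}.

Arguments sp_f {E X Y} _.
Arguments sp_s {E X Y} _.
Arguments sp_eq {E X Y} _.

Record Point (E : Category) : Type := {
  pt_dom : E;
  pt_cod : E;
  pt_split :> SplitEpi pt_dom pt_cod
}.

Arguments pt_dom {E} _.
Arguments pt_cod {E} _.
Arguments pt_split {E} _.

Definition pt {E : Category} {X Y : E} (p : SplitEpi X Y) : Point E :=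
  {| pt_dom := X; pt_cod := Y; pt_split := p |}.

Record PointMap {E : Category} (p q : Point E) : Type := {
  pm_y : Hom (pt_cod p) (pt_cod q);
  pm_x : Hom (pt_dom p) (pt_dom q);
  pm_f : sp_f q ∘ pm_x = pm_y ∘ sp_f p;
  pm_s : pm_x ∘ sp_s p = sp_s q ∘ pm_y
}.

Arguments pm_y {E p q} _.
Arguments pm_x {E p q} _.
Arguments pm_f {E p q} _.
Arguments pm_s {E p q} _.

Lemma PointMap_eq {E : Category} {p q : Point E} (a b : PointMap p q) :
  pm_y a = pm_y b -> pm_x a = pm_x b -> a = b.
Proof.
  destruct a, b; simpl; intros -> ->; f_equal; apply proof_irrelevance.
Qed.

Definition PointMap_id {E : Category} (p : Point E) : PointMap p p.
Proof.
  refine {| pm_y := id (pt_cod p); pm_x := id (pt_dom p) |};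
    rewrite comp_id_l, comp_id_r; reflexivity.
Defined.

Definition PointMap_comp {E : Category} {p q r : Point E}
    (b : PointMap q r) (a : PointMap p q) : PointMap p r.
Proof.
  refine {| pm_y := pm_y b ∘ pm_y a; pm_x := pm_x b ∘ pm_x a |}.
  - rewrite comp_assoc, pm_f, <- comp_assoc, pm_f, comp_assoc. reflexivity.
  - rewrite <- comp_assoc, pm_s, comp_assoc, pm_s, comp_assoc. reflexivity.
Defined.

Definition Pt (E : Category) : Category.
Proof.
  refine {|
    Ob := Point E;
    Hom := PointMap;
    id := PointMap_id;
    comp := @PointMap_comp E |};
  intros; apply PointMap_eq; simpl;
    solve [apply comp_id_l | apply comp_id_r | apply comp_assoc].
Defined.

(** The functor [ℙ] sending a split epimorphism to its codomain. *)
Definition PP (E : Category) : Functor (Pt E) E.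
Proof.
  refine {| fob := (fun p => pt_cod p) : Pt E -> E;
            fmap := fun p q (a : @Hom (Pt E) p q) => pm_y a |};
  reflexivity.
Defined.

Lemma cartesian_PP_iff {E : Category} (L : FinitelyComplete E) {p q : Pt E}
    (a : Hom p q) :
  cartesian (PP E) a <->
  is_pullback (pm_x a) (sp_f p) (sp_f q) (pm_y a).
Proof.
  split.
  - intros Ca. split; [apply pm_f|].
    set (P := pb L (sp_f q) (pm_y a)).
    assert (Hs : sp_f q ∘ (sp_s q ∘ pm_y a) = pm_y a ∘ id (pt_cod p))
      by (rewrite comp_assoc, sp_eq, comp_id_l, comp_id_r; reflexivity).
    pose (r := {| sp_f := pb2 L (sp_f q) (pm_y a);
                  sp_s := pb_pair L (sp_f q) (pm_y a) _ _ Hs;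
                  sp_eq := pb2_pair L _ _ _ _ Hs |} : SplitEpi P (pt_cod p)).
    assert (g2 : pb1 L (sp_f q) (pm_y a) ∘ sp_s r = sp_s q ∘ pm_y a)
      by apply pb1_pair.
    pose (g := Build_PointMap E (pt r) q (pm_y a) (pb1 L (sp_f q) (pm_y a))
                 (pb_comm L _ _) g2 : @Hom (Pt E) (pt r) q).
    destruct (Ca (pt r) g (id _) (comp_id_r _)) as [k [[k1 k2] _]].
    assert (e1 : pm_x a ∘ pm_x k = pb1 L (sp_f q) (pm_y a))
      by exact (f_equal pm_x k2).
    assert (e2 : sp_f p ∘ pm_x k = pb2 L (sp_f q) (pm_y a)).
    { rewrite (pm_f k). simpl in k1 |- *. rewrite k1. apply comp_id_l. }
    pose (n := pb_pair L (sp_f q) (pm_y a) (pm_x a) (sp_f p) (pm_f a)).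
    assert (n1 : pb1 L _ _ ∘ n = pm_x a) by apply pb1_pair.
    assert (n2 : pb2 L _ _ ∘ n = sp_f p) by apply pb2_pair.
    assert (kn : pm_x k ∘ n = id (pt_dom p)).
    { assert (ns : n ∘ sp_s p = sp_s r ∘ id _).
      { rewrite comp_id_r. apply pb_ext; rewrite comp_assoc.
        - rewrite n1, g2. apply pm_s.
        - rewrite n2, sp_eq. symmetry. apply (sp_eq r). }
      pose (nm := Build_PointMap E p (pt r) (id _) n
                    (eq_trans n2 (eq_sym (comp_id_l _))) ns
                  : @Hom (Pt E) p (pt r)).
      destruct (Ca p a (id _) (comp_id_r _)) as [u [_ Hu]].
      assert (E1 : u = k ∘ nm).
      { apply Hu. split.
        - simpl in k1 |- *. rewrite k1. apply comp_id_l.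
        - apply PointMap_eq; simpl.
          + simpl in k1. rewrite k1, !comp_id_r. reflexivity.
          + rewrite comp_assoc.
            exact (eq_trans (f_equal (fun t => t ∘ n) e1) n1). }
      assert (E2 : u = id p).
      { apply Hu. split; [reflexivity | apply comp_id_r]. }
      exact (f_equal pm_x (eq_trans (eq_sym E1) E2)). }
    intros T b c H. exists (pm_x k ∘ pb_pair L _ _ b c H). split.
    + split; rewrite comp_assoc.
      * rewrite e1. apply pb1_pair.
      * rewrite e2. apply pb2_pair.
    + intros m [m1 m2].
      rewrite <- (comp_id_l m), <- kn, <- comp_assoc. f_equal.
      apply pb_ext; rewrite comp_assoc.
      * rewrite pb1_pair, n1. auto.
      * rewrite pb2_pair, n2. auto.
  - intros [H U] z g h Hh. simpl in h, Hh.
    assert (Hg : sp_f q ∘ pm_x g = pm_y a ∘ (h ∘ sp_f z))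
      by (rewrite comp_assoc, Hh; apply pm_f).
    destruct (U _ _ _ Hg) as [m [[m1 m2] Hm]].
    assert (ms : m ∘ sp_s z = sp_s p ∘ h).
    { assert (Hs : sp_f q ∘ (pm_x g ∘ sp_s z) = pm_y a ∘ h).
      { rewrite (pm_s g), comp_assoc, sp_eq, comp_id_l. auto. }
      destruct (U _ _ _ Hs) as [n [_ Hn]].
      transitivity n; [symmetry|]; apply Hn; split; rewrite comp_assoc.
      - rewrite m1. reflexivity.
      - rewrite m2, <- comp_assoc, sp_eq. apply comp_id_r.
      - rewrite (pm_s a), <- comp_assoc, Hh. symmetry. apply (pm_s g).
      - rewrite sp_eq. apply comp_id_l. }
    exists (Build_PointMap E z p h m m2 ms). split.
    + split; [reflexivity|]. apply PointMap_eq; assumption.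
    + intros k [k1 k2]. apply PointMap_eq; simpl.
      * symmetry. exact k1.
      * apply Hm. split; [exact (f_equal pm_x k2)|].
        rewrite (pm_f k). simpl in k1. rewrite k1. reflexivity.
Qed.

(** * The fibres [Pt_Y E] and base-change *)

Record FibrePoint {E : Category} (Y : E) : Type := {
  fp_dom : E;
  fp_split :> SplitEpi fp_dom Y
}.

Arguments fp_dom {E Y} _.
Arguments fp_split {E Y} _.

(** A map of [Pt E] lying over [id Y]. *)
Record FibreMap {E : Category} {Y : E} (p q : FibrePoint Y) : Type := {
  fm_x : Hom (fp_dom p) (fp_dom q);
  fm_f : sp_f q ∘ fm_x = sp_f p;
  fm_s : fm_x ∘ sp_s p = sp_s q
}.

Arguments fm_x {E Y p q} _.
Arguments fm_f {E Y p q} _.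
Arguments fm_s {E Y p q} _.

Lemma FibreMap_eq {E : Category} {Y : E} {p q : FibrePoint Y}
    (a b : FibreMap p q) : fm_x a = fm_x b -> a = b.
Proof.
  destruct a, b; simpl; intros ->; f_equal; apply proof_irrelevance.
Qed.

Definition FibreMap_id {E : Category} {Y : E} (p : FibrePoint Y) :
  FibreMap p p :=
  {| fm_x := id (fp_dom p);
     fm_f := comp_id_r (sp_f p);
     fm_s := comp_id_l (sp_s p) |}.

Definition FibreMap_comp {E : Category} {Y : E} {p q r : FibrePoint Y}
    (b : FibreMap q r) (a : FibreMap p q) : FibreMap p r.
Proof.
  refine {| fm_x := fm_x b ∘ fm_x a |}.
  - rewrite comp_assoc, fm_f. apply fm_f.
  - rewrite <- comp_assoc, fm_s. apply fm_s.
Defined.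

Definition Pt_fibre {E : Category} (Y : E) : Category.
Proof.
  refine {|
    Ob := FibrePoint Y;
    Hom := FibreMap;
    id := FibreMap_id;
    comp := @FibreMap_comp E Y |};
  intros; apply FibreMap_eq; simpl;
    solve [apply comp_id_l | apply comp_id_r | apply comp_assoc].
Defined.

Lemma base_change_section {E : Category} {Y Y' : E} (y : Hom Y' Y)
    (p : FibrePoint Y) : sp_f p ∘ (sp_s p ∘ y) = y ∘ id Y'.
Proof. rewrite comp_assoc, sp_eq, comp_id_l, comp_id_r. reflexivity. Qed.

Definition base_change_ob {E : Category} (L : FinitelyComplete E) {Y Y' : E}
    (y : Hom Y' Y) (p : FibrePoint Y) : FibrePoint Y' :=
  {| fp_dom := pb L (sp_f p) y;
     fp_split :=
       {| sp_f := pb2 L (sp_f p) y;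
          sp_s := pb_pair L (sp_f p) y (sp_s p ∘ y) (id Y')
                    (base_change_section y p);
          sp_eq := pb2_pair L (sp_f p) y _ _ (base_change_section y p) |} |}.

Lemma base_change_square {E : Category} (L : FinitelyComplete E) {Y Y' : E}
    (y : Hom Y' Y) {p q : FibrePoint Y} (a : FibreMap p q) :
  sp_f q ∘ (fm_x a ∘ pb1 L (sp_f p) y) = y ∘ pb2 L (sp_f p) y.
Proof. rewrite comp_assoc, fm_f. apply pb_comm. Qed.

Definition base_change_map {E : Category} (L : FinitelyComplete E) {Y Y' : E}
    (y : Hom Y' Y) {p q : FibrePoint Y} (a : FibreMap p q) :
  FibreMap (base_change_ob L y p) (base_change_ob L y q).
Proof.
  refine {|
    fm_x := pb_pair L (sp_f q) y
              (fm_x a ∘ pb1 L (sp_f p) y) (pb2 L (sp_f p) y)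
              (base_change_square L y a)
              : Hom (fp_dom (base_change_ob L y p))
                    (fp_dom (base_change_ob L y q));
    fm_f := pb2_pair L (sp_f q) y _ _ (base_change_square L y a) |}.
  simpl. apply pb_ext; rewrite comp_assoc.
  - rewrite !pb1_pair, <- comp_assoc, pb1_pair, comp_assoc, fm_s. reflexivity.
  - rewrite !pb2_pair. reflexivity.
Defined.

Definition base_change {E : Category} (L : FinitelyComplete E) {Y Y' : E}
    (y : Hom Y' Y) : Functor (Pt_fibre Y) (Pt_fibre Y').
Proof.
  refine {|
    fob := base_change_ob L y : Pt_fibre Y -> Pt_fibre Y';
    fmap := fun p q (a : @Hom (Pt_fibre Y) p q) => base_change_map L y a |}.
  - intros p. apply FibreMap_eq; simpl.
    apply pb_ext; rewrite ?pb1_pair, ?pb2_pair, comp_id_r;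
      [apply comp_id_l | reflexivity].
  - intros p q r b a. apply FibreMap_eq; simpl.
    apply pb_ext; rewrite comp_assoc.
    + rewrite !pb1_pair, <- !comp_assoc, pb1_pair. reflexivity.
    + rewrite !pb2_pair. reflexivity.
Defined.

Definition protomodular {E : Category} (L : FinitelyComplete E) : Prop :=
  forall (Y Y' : E) (y : Hom Y' Y), conservative (base_change L y).

(** * Internal relations and Mal'tsev categories *)

Definition is_relation {E : Category} {R X : E} (d0 d1 : Hom R X) : Prop :=
  forall (T : E) (a b : Hom T R), d0 ∘ a = d0 ∘ b -> d1 ∘ a = d1 ∘ b -> a = b.

Definition rel_reflexive {E : Category} {R X : E} (d0 d1 : Hom R X) : Prop :=
  exists s0 : Hom X R, d0 ∘ s0 = id X /\ d1 ∘ s0 = id X.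

Definition rel_symmetric {E : Category} {R X : E} (d0 d1 : Hom R X) : Prop :=
  exists i : Hom R R, d0 ∘ i = d1 /\ d1 ∘ i = d0.

(** The pullback of [d1] along [d0] is the object of composable pairs. *)
Definition rel_transitive {E : Category} (L : FinitelyComplete E) {R X : E}
    (d0 d1 : Hom R X) : Prop :=
  exists m : Hom (pb L d1 d0) R,
    d0 ∘ m = d0 ∘ pb1 L d1 d0 /\ d1 ∘ m = d1 ∘ pb2 L d1 d0.

Definition equivalence_relation {E : Category} (L : FinitelyComplete E)
    {R X : E} (d0 d1 : Hom R X) : Prop :=
  is_relation d0 d1 /\ rel_reflexive d0 d1 /\ rel_symmetric d0 d1 /\
  rel_transitive L d0 d1.

Definition maltsev {E : Category} (L : FinitelyComplete E) : Prop :=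
  forall (X R : E) (d0 d1 : Hom R X),
    is_relation d0 d1 -> rel_reflexive d0 d1 -> equivalence_relation L d0 d1.

(* Main.v *)
Require Import Defs.

(** Part (i).  Let [(d0, d1)] be a reflexive relation on [X] with underlying
    object [R].  The inclusion of [R] in [X × X] is a monomorphism of points
    over [X], through the first projections and the diagonals, so by hypothesis
    it is an outsider.  Test this against the point formed by the kernel pair
    of [d0] over [R], whose elements are the pairs [bRa], [bRx].  The map
    [aRx ↦ (aRa, aRx)] from [R] to this kernel pair is cartesian, and
    composing it with [(bRa, bRx) ↦ (a, x)] gives the inclusion of [R].  The
    comparison map supplied by extremality says that [bRa] and [bRx] imply
    [aRx].  A reflexive relation with this property is symmetric (take [x = b])
    and transitive ([maltsev_of_outsiders]).

    Part (ii).  Let [w] be a monomorphism inverted by the base functor, and let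
    [w ∘ u = w' ∘ u'] with [u'] cartesian.  Since [w] is monic, everything
    reduces to factoring [w'] through [w], that is, to showing that the pullback
    of [w] along [w'] is invertible; this pullback is a map of points over the
    base of the codomain of [u'].  Its base-change along the base component of
    [u'] is the pullback of [w] along [w' ∘ u'], because [u'] is cartesian.  It
    is a split epimorphism as [w' ∘ u'] factors through [w], and it is monic,
    hence it is an isomorphism; protomodularity reflects this
    ([factors_through_mono]).  Both claims of part (ii) are instances of
    [extremal_of_protomodular], the first one with [u] an identity. *)

(** * Monomorphisms and isomorphisms *)

Lemma mono_comp {C : Category} {A B X : C} (g : Hom B X) (f : Hom A B) :
  is_mono g -> is_mono f -> is_mono (g ∘ f).
Proof.
  intros Hg Hf T a b H. apply Hf, Hg. rewrite !comp_assoc. exact H.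
Qed.

Lemma iso_mono {C : Category} {A B : C} (f : Hom A B) : is_iso f -> is_mono f.
Proof.
  intros [g [gf _]] T a b H.
  rewrite <- (comp_id_l a), <- (comp_id_l b), <- gf, <- !comp_assoc, H.
  reflexivity.
Qed.

Lemma mono_split_epi_iso {C : Category} {A B : C} (f : Hom A B) (g : Hom B A) :
  is_mono f -> f ∘ g = id B -> is_iso f.
Proof.
  intros Hf fg. exists g. split; [|exact fg].
  apply Hf. rewrite comp_assoc, fg, comp_id_l, comp_id_r. reflexivity.
Qed.

Lemma cartesian_id {C D : Category} (U : Functor C D) (A : C) :
  cartesian U (id A).
Proof.
  intros Z g h H. rewrite fmap_id, comp_id_l in H. exists g. split.
  - split; [auto | apply comp_id_l].
  - intros k [_ <-]. apply comp_id_l.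
Qed.

(** * Monomorphisms of points *)

Lemma mono_of_pm_x_mono {E : Category} {p q : Pt E} (v : Hom p q) :
  is_mono (pm_x v) -> is_mono v.
Proof.
  intros Hx T a b H.
  assert (Ex : pm_x a = pm_x b) by exact (Hx _ _ _ (f_equal pm_x H)).
  apply PointMap_eq; [|exact Ex].
  rewrite <- (comp_id_r (pm_y a)), <- (comp_id_r (pm_y b)), <- (sp_eq T).
  rewrite !comp_assoc, <- !pm_f, Ex. reflexivity.
Qed.

(** A monomorphism of points is tested against points only.  The kernel pair of
    the top component is one: invertibility of the base component makes both
    of its projections maps over the base, and the section of [p] paired with
    itself splits it. *)
Lemma pm_x_mono_of_mono {E : Category} (L : FinitelyComplete E) {p q : Pt E}
    (v : Hom p q) :
  is_mono v -> invertible (PP E) v -> is_mono (pm_x v).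
Proof.
  intros Hv Hy T a b H.
  assert (My : is_mono (pm_y v)) by exact (iso_mono _ Hy).
  pose (k1 := pb1 L (pm_x v) (pm_x v)).
  pose (k2 := pb2 L (pm_x v) (pm_x v)).
  assert (Hk : pm_x v ∘ k1 = pm_x v ∘ k2) by apply pb_comm.
  assert (Hf : sp_f p ∘ k1 = sp_f p ∘ k2).
  { apply My. rewrite !comp_assoc, <- pm_f, <- !comp_assoc, Hk. reflexivity. }
  pose (s := pb_pair L (pm_x v) (pm_x v) (sp_s p) (sp_s p) eq_refl).
  assert (s1 : k1 ∘ s = sp_s p) by apply pb1_pair.
  assert (s2 : k2 ∘ s = sp_s p) by apply pb2_pair.
  assert (Hs : (sp_f p ∘ k1) ∘ s = id (pt_cod p))
    by (rewrite <- comp_assoc, s1; apply sp_eq).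
  pose (K := pt {| sp_f := sp_f p ∘ k1; sp_s := s; sp_eq := Hs |}).
  assert (f1 : sp_f p ∘ k1 = id (pt_cod p) ∘ sp_f K)
    by (rewrite comp_id_l; reflexivity).
  assert (f2 : sp_f p ∘ k2 = id (pt_cod p) ∘ sp_f K)
    by (rewrite comp_id_l; symmetry; exact Hf).
  pose (m1 := Build_PointMap E K p (id _) k1 f1
                (eq_trans s1 (eq_sym (comp_id_r _))) : @Hom (Pt E) K p).
  pose (m2 := Build_PointMap E K p (id _) k2 f2
                (eq_trans s2 (eq_sym (comp_id_r _))) : @Hom (Pt E) K p).
  assert (M : m1 = m2).
  { apply Hv. apply PointMap_eq; [reflexivity | exact Hk]. }
  assert (Ek : k1 = k2) by exact (f_equal pm_x M).
  rewrite <- (pb1_pair L _ _ a b H), <- (pb2_pair L _ _ a b H).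
  fold k1 k2. rewrite Ek. reflexivity.
Qed.

(** * Binary products *)

Definition empty_category : Category.
Proof.
  refine {| Ob := Empty_set; Hom := fun _ _ => Empty_set;
            id := fun A => match A with end;
            comp := fun A _ _ _ _ => match A with end |}; intros [].
Defined.

Lemma empty_category_finite : finite_category empty_category.
Proof. split; [exists nil; intros [] | intros []]. Qed.

Definition empty_diagram (C : Category) : Functor empty_category C.
Proof.
  refine {| fob := fun i : empty_category => match i with end;
            fmap := fun i _ _ => match i with end |}; intros [].
Defined.

Definition empty_cone {C : Category} (T : C) : Cone (empty_diagram C).
Proof.
  refine {| apex := T; leg := fun j : empty_category => match j with end |};
    intros [].
Defined.

Lemma terminal_exists {C : Category} (L : FinitelyComplete C) :
  exists I : C, forall T : C, exists! f : Hom T I, True.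
Proof.
  pose (l := L empty_category empty_category_finite (empty_diagram C)).
  exists (apex l). intros T. exists (lim_lift l (empty_cone T)).
  split; [exact Logic.I|]. intros f _. symmetry.
  apply (lim_lift_unique l (empty_cone T)). intros [].
Qed.

Lemma product_exists {C : Category} (L : FinitelyComplete C) (A B : C) :
  exists (P : C) (p : Hom P A) (q : Hom P B),
    forall (T : C) (a : Hom T A) (b : Hom T B),
      exists! m : Hom T P, p ∘ m = a /\ q ∘ m = b.
Proof.
  destruct (terminal_exists L) as [I HI].
  destruct (HI A) as [f _], (HI B) as [g _].
  exists (pb L f g), (pb1 L f g), (pb2 L f g). intros T a b.
  apply (pb_is_pullback L f g).
  destruct (HI T) as [h [_ Hh]].
  rewrite <- (Hh (f ∘ a) Logic.I). apply Hh, Logic.I.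
Qed.

(** * Outsiders and the Mal'tsev property *)

(** The hypothesis on [t] is internally that [bRa] and [bRx] imply [aRx]. *)
Lemma equivalence_of_euclidean {E : Category} (L : FinitelyComplete E)
    {R X : E} (d0 d1 : Hom R X) (t : Hom (pb L d0 d0) R) :
  is_relation d0 d1 -> rel_reflexive d0 d1 ->
  d0 ∘ t = d1 ∘ pb1 L d0 d0 -> d1 ∘ t = d1 ∘ pb2 L d0 d0 ->
  equivalence_relation L d0 d1.
Proof.
  intros Hrel [s0 [e0 e1]] t0 t1.
  assert (Hsym : rel_symmetric d0 d1).
  { (* From [bRa] and [bRb] conclude [aRb]. *)
    assert (H : d0 ∘ id R = d0 ∘ (s0 ∘ d0))
      by (rewrite comp_assoc, e0, comp_id_l, comp_id_r; reflexivity).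
    exists (t ∘ pb_pair L d0 d0 _ _ H). split; rewrite comp_assoc.
    - rewrite t0, <- comp_assoc, pb1_pair. apply comp_id_r.
    - rewrite t1, <- comp_assoc, pb2_pair, comp_assoc, e1. apply comp_id_l. }
  split; [exact Hrel | split; [exists s0; auto | split; [exact Hsym|]]].
  destruct Hsym as [i [i0 i1]].
  (* From [aRb] and [bRc], hence [bRa] and [bRc], conclude [aRc]. *)
  assert (H : d0 ∘ (i ∘ pb1 L d1 d0) = d0 ∘ pb2 L d1 d0)
    by (rewrite comp_assoc, i0; apply pb_comm).
  exists (t ∘ pb_pair L d0 d0 _ _ H). split; rewrite comp_assoc.
  - rewrite t0, <- comp_assoc, pb1_pair, comp_assoc, i1. reflexivity.
  - rewrite t1, <- comp_assoc, pb2_pair. reflexivity.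
Qed.

Lemma maltsev_of_outsiders (E : Category) (L : FinitelyComplete E) :
  (forall (p q : Pt E) (v : Hom p q),
     is_mono v -> invertible (PP E) v -> outsider (PP E) v) ->
  maltsev L.
Proof.
  intros Hout X R d0 d1 Hrel [s0 [e0 e1]].
  (* [v : U → T] is the inclusion of [R] in [X × X]; [K] is the kernel pair of
     [d0] over [R], and [v = w ∘ u] the decomposition through it. *)
  destruct (product_exists L X X) as [P [p0 [p1 HP]]].
  assert (Pext : forall (T : E) (m n : Hom T P),
             p0 ∘ m = p0 ∘ n -> p1 ∘ m = p1 ∘ n -> m = n).
  { intros T m n H0 H1. destruct (HP T (p0 ∘ n) (p1 ∘ n)) as [k [_ Hk]].
    rewrite <- (Hk m (conj H0 H1)). apply Hk. auto. }
  destruct (HP X (id X) (id X)) as [dg [[dg0 dg1] _]].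
  destruct (HP R d0 d1) as [j [[j0 j1] _]].
  pose (k0 := pb1 L d0 d0). pose (k1 := pb2 L d0 d0).
  assert (Hk : d0 ∘ k0 = d0 ∘ k1) by apply pb_comm.
  destruct (HP _ (d1 ∘ k0) (d1 ∘ k1)) as [c [[c0 c1] _]].
  pose (dk := pb_pair L d0 d0 (id R) (id R) eq_refl).
  assert (dk0 : k0 ∘ dk = id R) by apply pb1_pair.
  assert (dk1 : k1 ∘ dk = id R) by apply pb2_pair.
  assert (Hl : d0 ∘ (s0 ∘ d0) = d0 ∘ id R)
    by (rewrite comp_assoc, e0, comp_id_l, comp_id_r; reflexivity).
  pose (l := pb_pair L d0 d0 _ _ Hl).
  assert (l0 : k0 ∘ l = s0 ∘ d0) by apply pb1_pair.
  assert (l1 : k1 ∘ l = id R) by apply pb2_pair.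
  pose (U := pt {| sp_f := d0; sp_s := s0; sp_eq := e0 |} : Pt E).
  pose (T := pt {| sp_f := p0; sp_s := dg; sp_eq := dg0 |} : Pt E).
  pose (K := pt {| sp_f := k0; sp_s := dk; sp_eq := dk0 |} : Pt E).
  assert (vf : p0 ∘ j = id X ∘ d0) by (rewrite comp_id_l; exact j0).
  assert (vs : j ∘ s0 = dg ∘ id X).
  { rewrite comp_id_r. apply Pext; rewrite comp_assoc.
    - rewrite j0, e0, dg0. reflexivity.
    - rewrite j1, e1, dg1. reflexivity. }
  pose (v := Build_PointMap E U T (id X) j vf vs : Hom U T).
  assert (us : l ∘ s0 = dk ∘ s0).
  { apply pb_ext; fold k0 k1; rewrite !comp_assoc.
    - rewrite l0, dk0, <- comp_assoc, e0, comp_id_r, comp_id_l. reflexivity.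
    - rewrite l1, dk1. reflexivity. }
  pose (u := Build_PointMap E U K s0 l l0 us : Hom U K).
  assert (ws : c ∘ dk = dg ∘ d1).
  { apply Pext; rewrite !comp_assoc.
    - rewrite c0, dg0, <- comp_assoc, dk0, comp_id_l, comp_id_r. reflexivity.
    - rewrite c1, dg1, <- comp_assoc, dk1, comp_id_l, comp_id_r. reflexivity. }
  pose (w := Build_PointMap E K T d1 c c0 ws : Hom K T).
  assert (jm : is_mono (pm_x v)).
  { intros Z a b H. simpl in H. apply Hrel.
    - rewrite <- j0, <- !comp_assoc, H. reflexivity.
    - rewrite <- j1, <- !comp_assoc, H. reflexivity. }
  assert (vi : invertible (PP E) v)
    by (exists (id X); split; apply comp_id_l).
  assert (uc : cartesian (PP E) u).
  { apply (cartesian_PP_iff L). split; [exact l0|].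
    intros Z a b H. simpl in *. exists (k1 ∘ a).
    assert (Hb : d0 ∘ (k1 ∘ a) = b).
    { rewrite comp_assoc, <- Hk, <- comp_assoc, H, comp_assoc, e0.
      apply comp_id_l. }
    split.
    - split; [|exact Hb]. apply pb_ext; fold k0 k1; rewrite comp_assoc.
      + rewrite l0, <- comp_assoc, Hb. symmetry. exact H.
      + rewrite l1. apply comp_id_l.
    - intros m [<- _]. rewrite comp_assoc, l1. apply comp_id_l. }
  assert (vwu : v = w ∘ u).
  { apply PointMap_eq; simpl.
    - symmetry. exact e1.
    - apply Pext; rewrite comp_assoc.
      + rewrite c0, j0, <- comp_assoc, l0, comp_assoc, e1, comp_id_l.
        reflexivity.
      + rewrite c1, j1, <- comp_assoc, l1, comp_id_r. reflexivity. }
  destruct (Hout U T v (mono_of_pm_x_mono v jm) vi) as [_ [_ [_ Hex]]].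
  destruct (Hex K u w uc vwu) as [t [[wt _] _]].
  assert (jt : j ∘ pm_x t = c) by exact (f_equal pm_x wt).
  apply (equivalence_of_euclidean L d0 d1 (pm_x t) Hrel).
  - exists s0. auto.
  - refine (eq_trans _ c0). rewrite <- jt, comp_assoc, j0. reflexivity.
  - refine (eq_trans _ c1). rewrite <- jt, comp_assoc, j1. reflexivity.
Qed.

(** * Protomodularity and extremal decompositions *)

Lemma fibre_iso {E : Category} {Y : E} {p q : Pt_fibre Y} (a : Hom p q) :
  is_iso (fm_x a) <-> is_iso a.
Proof.
  split.
  - intros [g [ga ag]].
    assert (gf : sp_f p ∘ g = sp_f q)
      by (rewrite <- (fm_f a), <- comp_assoc, ag; apply comp_id_r).
    assert (gs : g ∘ sp_s q = sp_s p)
      by (rewrite <- (fm_s a), comp_assoc, ga; apply comp_id_l).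
    exists (Build_FibreMap E Y q p g gf gs).
    split; apply FibreMap_eq; assumption.
  - intros [g [ga ag]]. exists (fm_x g).
    split; [exact (f_equal fm_x ga) | exact (f_equal fm_x ag)].
Qed.

(** [a] stands for the pullback of [w] along [w'], and [h] for the factorization
    of [u'] through it; cartesianness turns [h] into a section of the
    base-change of [a]. *)
Lemma protomodular_mono_iso {E : Category} (L : FinitelyComplete E)
    {Z : Pt E} {A : Pt_fibre (pt_cod Z)} (U : Pt E) (u : Hom U Z)
    (a : @Hom (Pt_fibre (pt_cod Z)) A
           {| fp_dom := pt_dom Z; fp_split := pt_split Z |})
    (h : Hom (pt_dom U) (fp_dom A)) :
  protomodular L -> cartesian (PP E) u ->
  is_mono (fm_x a) -> fm_x a ∘ h = pm_x u -> is_iso (fm_x a).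
Proof.
  intros HL Hu Ha Hh.
  apply fibre_iso, (HL _ _ (pm_y u)), fibre_iso.
  apply (cartesian_PP_iff L) in Hu. destruct Hu as [_ Hu].
  destruct (Hu _ _ _ (pb_comm L (sp_f Z) (pm_y u))) as [m [[m1 m2] _]].
  assert (H : sp_f A ∘ (h ∘ m) = pm_y u ∘ pb2 L (sp_f Z) (pm_y u)).
  { rewrite comp_assoc, <- (fm_f a), <- (comp_assoc (sp_f _)), Hh.
    rewrite <- pb_comm, <- m1. symmetry. apply comp_assoc. }
  apply (mono_split_epi_iso _ (pb_pair L (sp_f A) (pm_y u) _ _ H)); simpl.
  - intros T b c Hbc. apply pb_ext.
    + apply Ha. apply (f_equal (comp (pb1 L _ _))) in Hbc.
      rewrite !comp_assoc, !pb1_pair in Hbc. rewrite !comp_assoc. exact Hbc.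
    + apply (f_equal (comp (pb2 L _ _))) in Hbc.
      rewrite !comp_assoc, !pb2_pair in Hbc. exact Hbc.
  - apply pb_ext; rewrite comp_assoc, comp_id_r.
    + rewrite pb1_pair, <- comp_assoc, pb1_pair, <- m1, <- Hh.
      apply comp_assoc.
    + rewrite !pb2_pair. reflexivity.
Qed.

Lemma factors_through_mono {E : Category} (L : FinitelyComplete E)
    {U X T Z : Pt E} (u : Hom U X) (w : Hom X T) (u' : Hom U Z)
    (w' : Hom Z T) :
  protomodular L -> is_mono w -> invertible (PP E) w ->
  cartesian (PP E) u' -> w ∘ u = w' ∘ u' ->
  exists t : Hom Z X, w ∘ t = w'.
Proof.
  intros HL Hw Iw Hu' Heq.
  assert (Mx : is_mono (pm_x w)) by exact (pm_x_mono_of_mono L w Hw Iw).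
  assert (My : is_mono (pm_y w)) by exact (iso_mono _ Iw).
  destruct Iw as [g [gw wg]]. simpl in g, gw, wg.
  pose (a1 := pb1 L (pm_x w') (pm_x w)).
  pose (a2 := pb2 L (pm_x w') (pm_x w)).
  assert (Ha : pm_x w' ∘ a1 = pm_x w ∘ a2) by apply pb_comm.
  (* The inverse [g] of the base component of [w] gives the pullback of [w]
     along [w'] a section over the base of [Z]. *)
  assert (Hs : pm_x w' ∘ sp_s Z = pm_x w ∘ (sp_s X ∘ (g ∘ pm_y w'))).
  { rewrite !comp_assoc, (pm_s w), (pm_s w').
    rewrite <- (comp_assoc (sp_s T)), wg, comp_id_r. reflexivity. }
  pose (s := pb_pair L _ _ _ _ Hs).
  assert (s1 : a1 ∘ s = sp_s Z) by apply pb1_pair.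
  assert (As : (sp_f Z ∘ a1) ∘ s = id (pt_cod Z))
    by (rewrite <- comp_assoc, s1; apply sp_eq).
  pose (A := {| fp_split := {| sp_f := sp_f Z ∘ a1; sp_s := s; sp_eq := As |} |}
             : Pt_fibre (pt_cod Z)).
  pose (Z' := {| fp_dom := pt_dom Z; fp_split := pt_split Z |}
              : Pt_fibre (pt_cod Z)).
  pose (a := Build_FibreMap E (pt_cod Z) A Z' a1 eq_refl s1 : Hom A Z').
  assert (Hx : pm_x w' ∘ pm_x u' = pm_x w ∘ pm_x u)
    by exact (eq_sym (f_equal pm_x Heq)).
  assert (I1 : is_iso a1).
  { apply (protomodular_mono_iso L U u' a (pb_pair L _ _ _ _ Hx) HL Hu').
    - intros V b c H. simpl in H. apply pb_ext; [exact H|].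
      apply Mx. fold a2. rewrite !comp_assoc, <- Ha, <- !comp_assoc, H.
      reflexivity.
    - apply pb1_pair. }
  destruct I1 as [b [_ ab]].
  assert (wx : pm_x w ∘ (a2 ∘ b) = pm_x w').
  { rewrite comp_assoc, <- Ha, <- comp_assoc, ab. apply comp_id_r. }
  assert (wy : pm_y w ∘ (g ∘ pm_y w') = pm_y w').
  { rewrite comp_assoc, wg. apply comp_id_l. }
  assert (tf : sp_f X ∘ (a2 ∘ b) = (g ∘ pm_y w') ∘ sp_f Z).
  { apply My. rewrite (comp_assoc (pm_y w) (sp_f X)), <- pm_f, <- comp_assoc.
    rewrite wx, pm_f, (comp_assoc (pm_y w)), wy. reflexivity. }
  assert (ts : (a2 ∘ b) ∘ sp_s Z = sp_s X ∘ (g ∘ pm_y w')).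
  { apply Mx. rewrite (comp_assoc (pm_x w) (a2 ∘ b)), wx. exact Hs. }
  exists (Build_PointMap E Z X _ _ tf ts).
  apply PointMap_eq; assumption.
Qed.

Lemma extremal_of_protomodular {E : Category} (L : FinitelyComplete E)
    {U X T : Pt E} (u : Hom U X) (w : Hom X T) :
  protomodular L -> is_mono u -> cartesian (PP E) u ->
  is_mono w -> invertible (PP E) w ->
  extremal_decomposition (PP E) (w ∘ u) u w.
Proof.
  intros HL Mu Cu Mw Iw.
  split; [exact (mono_comp w u Mw Mu) | split; [reflexivity|]].
  split; [exact Cu|]. intros Z u' w' Cu' Heq.
  destruct (factors_through_mono L u w u' w' HL Mw Iw Cu' Heq) as [t wt].
  exists t. split.
  - split; [exact wt|]. apply Mw. rewrite comp_assoc, wt. symmetry. exact Heq.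
  - intros t' [wt' _]. apply Mw. rewrite wt, wt'. reflexivity.
Qed.

Theorem proposition2p1 :
  (forall (E : Category) (L : FinitelyComplete E),
     (forall (p q : Pt E) (v : Hom p q),
        is_mono v -> invertible (PP E) v -> outsider (PP E) v) ->
     maltsev L)
  /\
  (forall (E : Category) (L : FinitelyComplete E),
     protomodular L ->
     (forall (p q : Pt E) (v : Hom p q),
        is_mono v -> invertible (PP E) v -> outsider (PP E) v)
     /\
     (forall (X' Y' Xbar X Y : E)
             (p' : SplitEpi X' Y') (pbar : SplitEpi Xbar Y) (p : SplitEpi X Y)
             (u : @Hom (Pt E) (pt p') (pt pbar))
             (w : @Hom (Pt E) (pt pbar) (pt p)),
        is_mono u -> cartesian (PP E) u ->
        is_mono w -> invertible (PP E) w -> pm_y w = id Y ->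
        extremal_decomposition (PP E) (w ∘ u) u w)).
Proof.
  split; [exact maltsev_of_outsiders|].
  intros E L HL. split.
  - intros p q v Mv Iv. unfold outsider.
    rewrite <- (comp_id_r v) at 1.
    apply (extremal_of_protomodular L); auto using cartesian_id.
    intros T a b H. rewrite !comp_id_l in H. exact H.
  - intros X' Y' Xbar X Y p' pbar p u w Mu Cu Mw Iw _.
    apply (extremal_of_protomodular L); assumption.
Qed.
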